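(* Let $\phi$ be a SAT instance on $n$ variables, let $\mathbf Q\in\mathbb N$, and let $\mathbf x$ be the monomial basis $SOS_p^{\mathbf Q}$ of $\phi$. Let $\gamma\subseteq[n]$. Then: 1. if $|\gamma|\in\{1,2\}$, then $|\mathbf x^\gamma|\le 2n$; 2. if $|\gamma|\in\{3,4\}$, then $|\mathbf x^\gamma|\le 6$; 3. if $|\gamma|>4$, then $|\mathbf x^\gamma|=0$.
   Context: Notation: $[n]=\{1,\dots,n\}$; $\triangle$ is symmetric difference; for $\alpha\subseteq[n]$, $x^\alpha=\prod_{i\in\alpha}x_i$ with $x^\emptyset=1$. A SAT instance $\phi$ is a conjunction of clauses, each clause being a disjunction of literals and identified with the subset of $[n]$ of the indices of the variables appearing in it. The basis $SOS_p$ of $\phi$ is the set of monomials $\{1\}\cup\{x_i: i\in[n]\}\cup\{x_ix_j: i\ne j \text{ appear together in some clause of }\phi\}$. For $\mathbf Q\in\mathbb N$, $SOS_p^{\mathbf Q}=SOS_p\cup\{x_ix_j: i\neq j\text{ are both among the }\mathbf Q\text{ variables appearing in the highest number of clauses of }\phi\}$ (ties broken arbitrarily; duplicate monomials are removed; if $\mathbf Q\ge n$ all variables are taken). For a monomial basis $\mathbf x$ and $\gamma\subseteq[n]$, $\mathbf x^\gamma=\{(\alpha,\beta): \alpha,\beta\subseteq[n],\ x^\alpha\in\mathbf x,\ x^\beta\in\mathbf x,\ \alpha\triangle\beta=\gamma\}$ is a set of ordered pairs, and $|\mathbf x^\gamma|$ is its cardinality. *)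

(* Defs.v *)
From mathcomp Require Import all_boot.
From mathcomp Require Import finmap mpoly.

Set Implicit Arguments.
Unset Strict Implicit.
Unset Printing Implicit Defensive.

Local Open Scope fset_scope.

(* Variables are indexed by 'I_n instead of {1, ..., n}; (i, b) is the literal
   x_i if b is true and its negation otherwise. *)
Definition literal (n : nat) : Type := ('I_n * bool)%type.
Definition clause (n : nat) : Type := seq (literal n).
Definition sat_instance (n : nat) : Type := seq (clause n).

Definition clause_vars (n : nat) (c : clause n) : {set 'I_n} :=
  [set i | i \in map fst c].

(* Clauses with the same variables but different signs are counted separately. *)
Definition occurrences (n : nat) (phi : sat_instance n) (i : 'I_n) : nat :=
  count (fun c => i \in clause_vars c) phi.

Definition appear_together (n : nat) (phi : sat_instance n) (i j : 'I_n) : bool :=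
  has (fun c => (i \in clause_vars c) && (j \in clause_vars c)) phi.

(* Monomials are elements of the commutative monoid 'X_{1..n} of exponent
   vectors, written additively: 0 is the monomial 1, U_(i) is x_i and
   U_(i) + U_(j) is x_i x_j.  For alpha : {set 'I_n}, the monomial x^alpha is
   mesym1 alpha. *)
Definition monomial_basis (n : nat) : Type := {fset 'X_{1..n}}.

Definition pair_monomials (n : nat) (r : rel 'I_n) : monomial_basis n :=
  [fset (U_(p.1) + U_(p.2))%MM
     | p in [pred p : 'I_n * 'I_n | (p.1 != p.2) && r p.1 p.2]].

Definition SOSp (n : nat) (phi : sat_instance n) : monomial_basis n :=
  [fset 0%MM] `|` [fset U_(i)%MM | i in 'I_n] `|`
  pair_monomials (appear_together phi).

(* T is a possible choice of the Q most frequent variables; several T qualify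
   when there are ties. *)
Definition most_frequent (n : nat) (phi : sat_instance n) (Q : nat)
    (T : {set 'I_n}) : Prop :=
  #|T| = minn Q n /\
  (forall i j : 'I_n,
     i \in T -> j \notin T -> occurrences phi j <= occurrences phi i).

(* x is the basis SOS_p^Q of phi for some way of breaking the ties. *)
Definition is_SOSpQ (n : nat) (phi : sat_instance n) (Q : nat)
    (x : monomial_basis n) : Prop :=
  exists2 T : {set 'I_n}, most_frequent phi Q T &
    x = SOSp phi `|` pair_monomials (fun i j => (i \in T) && (j \in T)).

Definition symdiff (n : nat) (A B : {set 'I_n}) : {set 'I_n} :=
  (A :\: B) :|: (B :\: A).

Definition basis_pairs (n : nat) (x : monomial_basis n) (gamma : {set 'I_n}) :
    {set {set 'I_n} * {set 'I_n}} :=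
  [set p | [&& mesym1 p.1 \in x, mesym1 p.2 \in x & symdiff p.1 p.2 == gamma]].

(* Main.v *)
(* Every monomial of the basis has degree at most 2, so both members of a pair
   (alpha, beta) with symmetric difference gamma have at most two elements, and
   |gamma| + 2 |alpha :&: beta| = |alpha| + |beta| <= 4, so |gamma| <= 4.  If gamma
   contains i, then exactly one of alpha and beta contains i, so it is {i, k}
   for some k, and it determines the other one: this leaves at most 2 n pairs.
   If |gamma| >= 3, then alpha and beta are disjoint, so alpha is a subset of
   gamma of size 1 or 2 when |gamma| = 3, and of size 2 when |gamma| = 4. *)
Require Import Defs.
From mathcomp Require Import all_boot.
From mathcomp Require Import finmap mpoly.
From mathcomp Require Import zify.

Section SymmetricDifference.

Variable n : nat.
Implicit Types A B : {set 'I_n}.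

Lemma in_symdiff A B i : (i \in symdiff A B) = (i \in A) (+) (i \in B).
Proof. by rewrite !inE; case: (i \in A); case: (i \in B). Qed.

Lemma symdiffC A B : symdiff A B = symdiff B A.
Proof. exact: setUC. Qed.

Lemma symdiffK A B : symdiff A (symdiff A B) = B.
Proof. by apply/setP => i; rewrite !in_symdiff addKb. Qed.

(** The two differences are disjoint, and [A :&: B] is counted once in [#|A|] and once in [#|B|]. *)
Lemma card_symdiff A B :
  #|symdiff A B| + 2 * #|A :&: B| = #|A| + #|B|.
Proof.
have disj : [disjoint A :\: B & B :\: A].
  rewrite -setI_eq0; apply/eqP/setP => i.
  by rewrite !inE; case: (i \in A); rewrite ?andbF.
move: disj; rewrite -(leq_card_setU (A :\: B) (B :\: A)) => /eqP ->.
have := cardsID B A; have := cardsID A B.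
rewrite (setIC B A); lia.
Qed.

(** The choice [k = i] covers the singleton. *)
Lemma card_le2_in A i : i \in A -> #|A| <= 2 -> exists k, A = [set i; k].
Proof.
move=> iA; rewrite (cardsD1 i A) iA ltnS.
rewrite leq_eqVlt ltnS leqn0 cards_eq0 => /orP[/cards1P[k Ek] | /eqP E0].
  by exists k; rewrite -(setD1K iA) Ek.
by exists i; rewrite -(setD1K iA) E0 setU0 setUid.
Qed.

End SymmetricDifference.

Section BasisPairs.

Variables (n : nat) (x : monomial_basis n).
Hypothesis mdeg_x : forall m, m \in x -> mdeg m <= 2.
Implicit Types (A gamma : {set 'I_n}) (p : {set 'I_n} * {set 'I_n}).

(** As [mesym1 A] has degree [#|A|], the degree bound on [x] bounds cardinalities. *)
Lemma basis_pairsP gamma p : p \in basis_pairs x gamma ->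
  [/\ #|p.1| <= 2, #|p.2| <= 2 & symdiff p.1 p.2 = gamma].
Proof.
rewrite inE => /and3P[/mdeg_x + /mdeg_x + /eqP].
by rewrite !mdeg_mesym1.
Qed.

Lemma card_basis_pairs_le2n gamma :
  0 < #|gamma| -> #|basis_pairs x gamma| <= 2 * n.
Proof.
case/card_gt0P => i igamma.
(* [f] covers the pairs with [i] in the first component, [g] those with [i] in the second. *)
pose f (k : 'I_n) := ([set i; k], symdiff [set i; k] gamma).
pose g (k : 'I_n) := (symdiff [set i; k] gamma, [set i; k]).
have sub : basis_pairs x gamma \subset f @: setT :|: g @: setT.
  apply/subsetP => -[A B] /basis_pairsP[/= cA cB defg].
  move: igamma; rewrite -defg in_symdiff inE.
  case: (boolP (i \in A)) => [iA _ | _ iB].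
    have [k EA] := card_le2_in _ _ _ iA cA.
    apply/orP; left; apply/imsetP; exists k => //.
    by rewrite /f -EA -defg symdiffK.
  have [k EB] := card_le2_in _ _ _ iB cB.
  apply/orP; right; apply/imsetP; exists k => //.
  by rewrite /g -EB -defg (symdiffC _ A) symdiffK.
apply: leq_trans (subset_leq_card sub) _.
apply: leq_trans (leq_card_setU _ _) _.
rewrite mul2n -addnn leq_add // (leq_trans (leq_imset_card _ _)) //.
  by rewrite cardsT card_ord.
by rewrite cardsT card_ord.
Qed.

(** The first projection is injective, since the second component is [symdiff p.1 gamma]. *)
Lemma card_basis_pairs_fst gamma :
  #|basis_pairs x gamma| = #|fst @: basis_pairs x gamma|.
Proof.
rewrite card_in_imset // => -[A B] [A' B'].
move=> /basis_pairsP[_ _ /= defg] /basis_pairsP[_ _ /= defg'] eqA.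
by rewrite -(symdiffK _ A B) -(symdiffK _ A' B') defg defg' eqA.
Qed.

Lemma basis_pairs_subset gamma p : 2 < #|gamma| -> p \in basis_pairs x gamma ->
  p.1 \subset gamma /\ #|gamma| <= #|p.1| + 2.
Proof.
move=> gt2 /basis_pairsP[c1 c2 defg]; have := card_symdiff _ p.1 p.2.
rewrite defg => card_eq; split; last by lia.
(* A common element would force [#|gamma| <= 4 - 2]. *)
have /eqP : #|p.1 :&: p.2| = 0 by lia.
rewrite cards_eq0 setI_eq0 -defg => /disjoint_setI0 I0.
apply/subsetP => i i1; rewrite in_symdiff i1 /=.
by apply/negP => i2; have := in_set0 i; rewrite -I0 inE i1 i2.
Qed.

Lemma card_basis_pairs_le6 gamma :
  #|gamma| = 3 \/ #|gamma| = 4 -> #|basis_pairs x gamma| <= 6.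
Proof.
move=> card_gamma; rewrite card_basis_pairs_fst.
pose draws k := [set A : {set 'I_n} | A \subset gamma & #|A| == k].
have sub (D : {set {set 'I_n}}) :
    (forall A, A \subset gamma -> #|A| <= 2 -> #|gamma| <= #|A| + 2 -> A \in D) ->
    #|fst @: basis_pairs x gamma| <= #|D|.
  move=> inD; apply/subset_leq_card/subsetP => _ /imsetP[p p_in ->].
  have [c1 _ _] := basis_pairsP _ _ p_in.
  have [|s1 cg] := basis_pairs_subset _ _ _ p_in; first by lia.
  exact: inD.
case: card_gamma => card_gamma.
  apply: leq_trans (sub (draws 1 :|: draws 2) _) _.
    move=> A sA; rewrite card_gamma !inE sA /=; lia.
  (* Here 6 is the sum of the binomials C(3,1) and C(3,2). *)
  by apply: leq_trans (leq_card_setU _ _) _; rewrite !cards_draws card_gamma.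
apply: leq_trans (sub (draws 2) _) _.
  move=> A sA; rewrite card_gamma !inE sA /=; lia.
(* Here 6 is C(4,2). *)
by rewrite cards_draws card_gamma.
Qed.

Lemma basis_pairs_eq0 gamma : 4 < #|gamma| -> basis_pairs x gamma = set0.
Proof.
move=> gt4; apply/setP => p; rewrite in_set0; apply: contraTF gt4.
move=> /basis_pairsP[c1 c2 <-]; rewrite -leqNgt.
by apply: leq_trans (leq_add c1 c2); rewrite -card_symdiff leq_addr.
Qed.

End BasisPairs.

Lemma mdeg_pair_monomials n (r : rel 'I_n) m :
  m \in pair_monomials r -> mdeg m = 2.
Proof. by case/imfsetP => p _ ->; rewrite mdegD !mdeg1. Qed.

(** The constant, the variables, the clause pairs and the pairs from [T] have degrees 0, 1, 2 and
    2. *)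
Lemma mdeg_SOSpQ n (phi : sat_instance n) Q x m :
  is_SOSpQ phi Q x -> m \in x -> mdeg m <= 2.
Proof.
case=> T _ ->; rewrite !in_fsetU => /orP[/orP[/orP[]|]|].
- by rewrite in_fset1 => /eqP ->; rewrite mdeg0.
- by case/imfsetP => i _ ->; rewrite mdeg1.
- by move/mdeg_pair_monomials ->.
- by move/mdeg_pair_monomials ->.
Qed.

Theorem lemma2 (n : nat) (phi : sat_instance n) (Q : nat) (x : monomial_basis n)
    (hx : is_SOSpQ phi Q x) (gamma : {set 'I_n}) :
  [/\ (#|gamma| = 1 \/ #|gamma| = 2 -> #|basis_pairs x gamma| <= 2 * n),
      (#|gamma| = 3 \/ #|gamma| = 4 -> #|basis_pairs x gamma| <= 6)
    & (4 < #|gamma| -> #|basis_pairs x gamma| = 0)].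
Proof.
have mdeg_x m : m \in x -> mdeg m <= 2 by exact: mdeg_SOSpQ hx.
split.
- by move=> card_gamma; apply: card_basis_pairs_le2n => //; lia.
- exact: card_basis_pairs_le6.
- by move=> gt4; rewrite basis_pairs_eq0 ?cards0.
Qed.
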